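(* Let $\mathbf A=(A,\leq)$ be a distributive poset and $a,b\in A$ with $a\leq b$, and assume that there exists an orthocomplementation ${}'$ on $([a,b],\leq)$, where $[a,b]=\{x\in A\mid a\leq x\leq b\}$. Further, assume that for every $x\in A$ satisfying $L(a)\subset L(U(x,a),b)\subset L(b)$ (both inclusions proper) we have $L(U(x,a),b)=L(x)$. Then $\mathbf A$ can be $LU$-embedded into $\big(P_{\{a,b\}}(\mathbf A),\sqsubseteq\big)$ (i.e. there exists an $LU$-embedding from $\mathbf A$ to this poset), and the poset $([a,b],\leq,{}')$ is Boolean.
   Context: Let $(A,\leq)$ be a poset. For $B,C\subseteq A$, $B\leq C$ means $x\leq y$ for all $x\in B$, $y\in C$ (singletons are written without braces). For $B\subseteq A$: $L(B)=\{x\in A\mid x\leq B\}$, $U(B)=\{x\in A\mid B\leq x\}$. Several arguments denote the union: $L(B,C)=L(B\cup C)$, $L(b,c)=L(\{b,c\})$, $L(B,c)=L(B\cup\{c\})$, and similarly for $U$; $LU(B)=L(U(B))$, $UL(B)=U(L(B))$. The poset is distributive if $L\big(U(x,y),z\big)=LU\big(L(x,z),L(y,z)\big)$ for all $x,y,z\in A$. An element $y$ is a complement of $x$ if $L(x,y)=L(A)$ and $U(x,y)=U(A)$; a poset is complemented if each element has a complement, and Boolean if it is distributive and complemented. An antitone involution on a poset is a unary operation ${}'$ with $x\leq y\Rightarrow y'\leq x'$ and $x''=x$. If the poset has a least element $0$ and a greatest element $1$, an antitone involution ${}'$ is an orthocomplementation if $L(x,x')=\{0\}$ and $U(x,x')=\{1\}$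 for all $x$ (here, for the poset $[a,b]$, cones are computed in $[a,b]$, $0=a$, $1=b$). For a non-empty subset $S\subseteq A$, $P_S(\mathbf A)=\{(x,y)\in A^2\mid L(x,y)\leq S\leq U(x,y)\}$, ordered by $(x,y)\sqsubseteq(z,u)$ iff $x\leq z$ and $u\leq y$. An order-preserving map $f$ between posets is an $LU$-morphism if $L\big(f(X)\big)=L\big(f(UL(X))\big)$ and $U\big(f(Y)\big)=U\big(f(LU(Y))\big)$ for all non-empty finite subsets $X,Y$ of the domain. An $LU$-embedding is an $LU$-morphism that is order reflecting ($f(x)\leq f(y)$ implies $x\leq y$). *)

(* Defs.v *)
From HB Require Import structures.
From mathcomp Require Import all_boot all_order.
From mathcomp Require Import mathcomp_extra boolp classical_sets cardinality.

Set Implicit Arguments.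
Unset Strict Implicit.
Unset Printing Implicit Defensive.
Set Warnings "-redundant-canonical-projection".

Import Order.TTheory.
Local Open Scope classical_set_scope.
Local Open Scope order_scope.

(* The cones L(B) and U(B) are [lbound B] and [ubound B] of classical_sets;
   several arguments are rendered by the union of the corresponding sets. *)

Definition set_le d (P : porderType d) (B C : set P) : Prop :=
  forall x y, B x -> C y -> x <= y.

Definition distributive_poset d (P : porderType d) : Prop :=
  forall x y z : P,
    lbound (ubound [set x; y] `|` [set z]) =
    lbound (ubound (lbound [set x; z] `|` lbound [set y; z])).

Definition complement_of d (P : porderType d) (x y : P) : Prop :=
  lbound [set x; y] = lbound [set: P] /\ ubound [set x; y] = ubound [set: P].

Definition complemented_poset d (P : porderType d) : Prop :=
  forall x : P, exists y : P, complement_of x y.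

Definition boolean_poset d (P : porderType d) : Prop :=
  distributive_poset P /\ complemented_poset P.

Definition antitone_involution d (P : porderType d) (c : P -> P) : Prop :=
  (forall x y : P, x <= y -> c y <= c x) /\ (forall x : P, c (c x) = x).

Definition orthocomplementation d (P : tbPOrderType d) (c : P -> P) : Prop :=
  antitone_involution c /\
  (forall x : P, lbound [set x; c x] = [set \bot] /\
                 ubound [set x; c x] = [set \top]).

(* The proof [a <= b] is a parameter of the type because it is needed to give
   the interval its least element [a] and its greatest element [b]. *)
Definition subitv d (A : porderType d) (a b : A) (hab : a <= b) : Type :=
  {x : A | a <= x <= b}.

Section SubitvPoset.
Context {d : Order.disp_t} {A : porderType d} {a b : A} (hab : a <= b).

HB.instance Definition _ := SubChoice.on (subitv hab).
HB.instance Definition _ :=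
  [SubChoice_isSubPOrder of subitv hab by <: with d].

Lemma subitv_bot_subproof : a <= a <= b.
Proof. by rewrite lexx hab. Qed.

Lemma subitv_top_subproof : a <= b <= b.
Proof. by rewrite hab lexx. Qed.

Definition subitv_bot : subitv hab := Sub a subitv_bot_subproof.
Definition subitv_top : subitv hab := Sub b subitv_top_subproof.

Lemma subitv_bot_le (x : subitv hab) : subitv_bot <= x.
Proof. by have /andP[] := valP x. Qed.

Lemma subitv_le_top (x : subitv hab) : x <= subitv_top.
Proof. by have /andP[] := valP x. Qed.

HB.instance Definition _ :=
  Order.hasBottom.Build d (subitv hab) subitv_bot_le.
HB.instance Definition _ :=
  Order.hasTop.Build d (subitv hab) subitv_le_top.

End SubitvPoset.

Definition twist_set d (A : porderType d) (S : set A) : set (A * A) :=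
  [set p | set_le (lbound [set p.1; p.2]) S /\
           set_le S (ubound [set p.1; p.2])].

Definition twist d (A : porderType d) (S : set A) : Type :=
  {p : A * A | p \in twist_set S}.

Section TwistPoset.
Context {d : Order.disp_t} {A : porderType d} (S : set A).

HB.instance Definition _ := SubChoice.on (twist S).

Definition twist_le (p q : twist S) : bool :=
  ((val p).1 <= (val q).1) && ((val q).2 <= (val p).2).

Lemma twist_le_refl : reflexive twist_le.
Proof. by move=> p; rewrite /twist_le !lexx. Qed.

Lemma twist_le_anti : antisymmetric twist_le.
Proof.
move=> p q /andP[/andP[pq1 qp2] /andP[qp1 pq2]]; apply: val_inj.
rewrite [LHS]surjective_pairing [RHS]surjective_pairing.
by congr pair; apply/le_anti; rewrite ?pq1 ?qp1 ?pq2 ?qp2.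
Qed.

Lemma twist_le_trans : transitive twist_le.
Proof.
move=> q p r /andP[pq1 qp2] /andP[qr1 rq2].
by rewrite /twist_le (le_trans pq1 qr1) (le_trans rq2 qp2).
Qed.

HB.instance Definition _ :=
  Order.Le_isPOrder.Build d (twist S) twist_le_refl twist_le_anti
    twist_le_trans.

End TwistPoset.

Definition LU_morphism d d' (P : porderType d) (Q : porderType d')
    (f : P -> Q) : Prop :=
  [/\ forall x y : P, x <= y -> f x <= f y,
      forall X : set P, X !=set0 -> finite_set X ->
        lbound (f @` X) = lbound (f @` ubound (lbound X))
    & forall Y : set P, Y !=set0 -> finite_set Y ->
        ubound (f @` Y) = ubound (f @` lbound (ubound Y))].

Definition LU_embedding d d' (P : porderType d) (Q : porderType d')
    (f : P -> Q) : Prop :=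
  LU_morphism f /\ (forall x y : P, f x <= f y -> x <= y).

(* Main.v *)
Require Import Defs.
From mathcomp Require Import all_boot all_order.
From mathcomp Require Import mathcomp_extra boolp classical_sets cardinality.

Set Implicit Arguments.
Unset Strict Implicit.
Unset Printing Implicit Defensive.

Import Order.TTheory.
Local Open Scope classical_set_scope.
Local Open Scope order_scope.

(** The hypothesis on [A] says that every [x] has a shadow on the interval:
    an element [p x] of [[a, b]] with [L(U(x, a), b) = L(p x)], namely [a],
    [b] or [x] itself.  From then on only the existence of [p] matters, and not
    which of the three cases holds.  In a lattice [p x] would be
    [(x \/ a) /\ b = (x /\ b) \/ a], and both descriptions survive in a
    distributive poset ([le_shadow] and [shadow_le]).  Consequently [p] is
    monotone, fixes [[a, b]] pointwise, lies above every [x <= b] and below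
    every [x >= a].

    The embedding is [f x = (x, (p x)')].  It reflects the order because of
    its first component.  Its values lie in [P_{a,b}]: if [w] is below [x] and
    [(p x)'], then [w <= b], so [w <= p w], while [p w] is below [p x] and
    [(p x)'], hence [w <= p w = a]; the upper half is dual.

    Distributivity enters through an equivalent condition, the cut rule: [t <= w]
    as soon as [t <= U(x, w)] and [L(x, t) <= w] for some [x].  It is self-dual
    and extends by induction to finitely many cut elements ([cut_lower],
    [cut_upper]).  These finite versions give the two identities of an
    [LU]-morphism: a bound [u] of the second components is replaced by its
    shadow [p u], so that the involution turns it into a bound of the shadows
    [p x], to which the finite cut applies.

    The interval is complemented by assumption, and the cut rule passes from
    [A] to [[a, b]], since a bound taken in [A] can be replaced by its shadow. *)

(** * Cones of pairs *)

Lemma ubound2E d (A : porderType d) (x y z : A) :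
  ubound [set x; y] z <-> x <= z /\ y <= z.
Proof.
split=> [h|[xz yz] _ [->|->]] //.
by split; apply: h; [left|right].
Qed.

Lemma lbound2E d (A : porderType d) (x y z : A) :
  lbound [set x; y] z <-> z <= x /\ z <= y.
Proof.
split=> [h|[zx zy] _ [->|->]] //.
by split; apply: h; [left|right].
Qed.

Lemma lbound1E d (A : porderType d) (x z : A) : lbound [set x] z <-> z <= x.
Proof. by split=> [|zx _ ->]; first exact. Qed.

Lemma lboundU1E d (A : porderType d) (B : set A) (y z : A) :
  lbound (B `|` [set y]) z <-> lbound B z /\ z <= y.
Proof.
split=> [h|[zB zy] v [/zB|->]] //.
by split=> [v Bv|]; apply: h; [left|right].
Qed.

(** * Distributivity as a cut rule *)

(** In a lattice: [t <= x \/ w] and [x /\ t <= w] imply [t <= w], as in the cut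
    rule of the sequent calculus. *)
Definition cut_rule d (A : porderType d) : Prop :=
  forall x t w : A,
    lbound (ubound [set x; w]) t -> ubound (lbound [set x; t]) w -> t <= w.

(** Apply the distributive law to [L(U(x, w), t)], which contains [t]; on the
    other side, [w] is an upper bound of [L(x, t)] and [L(w, t)]. *)
Lemma distributive_cut d (A : porderType d) :
  distributive_poset A -> cut_rule A.
Proof.
move=> Adist x t w txw wxt.
have : lbound (ubound [set x; w] `|` [set t]) t by apply/lboundU1E.
rewrite Adist; apply=> v [/wxt //|/lbound2E[]//].
Qed.

(** The inclusion of [L(U(x, y), z)] in [LU(L(x, z), L(y, z))] needs two cuts:
    one on [x], and one on [y] to establish the first premise of the former. *)
Lemma cut_distributive d (A : porderType d) :
  cut_rule A -> distributive_poset A.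
Proof.
move=> cut x y z; apply/seteqP; split=> t.
- move=> /lboundU1E[txy tz] w wU.
  have wx v : v <= x -> v <= t -> v <= w.
    by move=> vx vt; apply: wU; left; apply/lbound2E;
      split=> //; apply: le_trans vt _.
  have wy v : v <= y -> v <= t -> v <= w.
    by move=> vy vt; apply: wU; right; apply/lbound2E;
      split=> //; apply: le_trans vt _.
  apply: (cut x) => [v /ubound2E[xv wv]|v /lbound2E[]]; last exact: wx.
  apply: (cut y) => [r /ubound2E[yr vr]|r /lbound2E[ry rt]].
    by apply: txy; apply/ubound2E; split=> //; apply: le_trans xv _.
  exact: le_trans (wy _ ry rt) wv.
- move=> tU; apply/lboundU1E; split=> [w /ubound2E[xw yw]|]; apply: tU.
    by move=> v [] /lbound2E[vxy _]; apply: le_trans vxy _.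
  by move=> v [] /lbound2E[].
Qed.

(** Cutting on the elements of [s] one at a time: a lower bound [t] of the
    first element and of [c] inherits the hypotheses on [c], so the induction
    applies to [t]. *)
Lemma cut_lower d (A : porderType d) (s : seq A) (c w : A) :
  cut_rule A ->
  (forall x, x \in s -> lbound (ubound [set x; w]) c) ->
  (forall t, t <= c -> (forall x, x \in s -> t <= x) -> t <= w) ->
  c <= w.
Proof.
move=> cut; elim: s c => [|x s IH] c cs ws; first exact: ws.
apply: (cut x); first by apply: cs; rewrite mem_head.
move=> t /lbound2E[tx tc]; apply: IH => [y ys v yv|r rt rs].
  by apply: le_trans tc _; apply: (cs y) yv; rewrite in_cons ys orbT.
apply: ws => [|y]; first exact: le_trans tc.
by rewrite in_cons => /orP[/eqP->|/rs//]; apply: le_trans tx.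
Qed.

(** The order dual of [cut_lower]; it follows from the same rule because the
    cut rule is self-dual. *)
Lemma cut_upper d (A : porderType d) (s : seq A) (t w : A) :
  cut_rule A ->
  (forall y, y \in s -> ubound (lbound [set y; t]) w) ->
  (forall v, w <= v -> (forall y, y \in s -> y <= v) -> t <= v) ->
  t <= w.
Proof.
move=> cut; elim: s w => [|y s IH] w ws ts; first exact: ts.
apply: (cut y); last by apply: ws; rewrite mem_head.
move=> v /ubound2E[yv wv]; apply: IH => [x xs r xr|r vr rs].
  by apply: le_trans _ wv; apply: (ws x) xr; rewrite in_cons xs orbT.
apply: ts => [|x]; first exact: le_trans vr.
by rewrite in_cons => /orP[/eqP->|/rs//]; apply: le_trans vr.
Qed.

(** * Shadows on the interval *)

(** The equation makes [p x] the substitute for [(x \/ a) /\ b]. *)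
Definition shadow_map d (A : porderType d) (a b : A) (hab : a <= b)
    (p : A -> subitv hab) : Prop :=
  forall x : A,
    lbound (ubound [set x; a] `|` [set b]) = lbound [set val (p x)].

(** [L(U(x, a), b)] always lies between [L(a)] and [L(b)]; at the two extremes
    the shadow is [a] or [b], and strictly in between the hypothesis makes [x]
    its own shadow, which puts [x] in the interval. *)
Lemma shadow_map_exists d (A : porderType d) (a b : A) (hab : a <= b) :
  (forall x : A,
      lbound [set a] `<` lbound (ubound [set x; a] `|` [set b]) ->
      lbound (ubound [set x; a] `|` [set b]) `<` lbound [set b] ->
      lbound (ubound [set x; a] `|` [set b]) = lbound [set x]) ->
  exists p : A -> subitv hab, shadow_map p.
Proof.
move=> hx.
suff /choice[p hp] : forall x, exists c : subitv hab,
    lbound (ubound [set x; a] `|` [set b]) = lbound [set val c] by exists p.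
move=> x; set T := lbound _.
have Ta : T a by apply/lboundU1E; split=> // v /ubound2E[].
have aT : lbound [set a] `<=` T.
  move=> t /lbound1E ta; apply/lboundU1E.
  by split=> [v /ubound2E[_ av]|]; [exact: le_trans av|exact: le_trans hab].
have Tb : T `<=` lbound [set b] by move=> t /lboundU1E[_ /lbound1E].
have [Ea|Na] := pselect (T `<=` lbound [set a]).
  by exists (subitv_bot hab); apply/seteqP.
have [Eb|Nb] := pselect (lbound [set b] `<=` T).
  by exists (subitv_top hab); apply/seteqP.
have Tx : T = lbound [set x] by apply: hx; split.
have ax : a <= x by apply/lbound1E; rewrite -Tx.
have xb : x <= b.
  by apply/lbound1E; apply: Tb; rewrite Tx; apply/lbound1E.
have axb : a <= x <= b by rewrite ax xb.
by exists (exist _ x axb).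
Qed.

Lemma subitv_ge d (A : porderType d) (a b : A) (hab : a <= b)
  (c : subitv hab) : a <= val c.
Proof. by have /andP[] := valP c. Qed.

Lemma subitv_le d (A : porderType d) (a b : A) (hab : a <= b)
  (c : subitv hab) : val c <= b.
Proof. by have /andP[] := valP c. Qed.

Lemma le_shadow d (A : porderType d) (a b : A) (hab : a <= b)
    (p : A -> subitv hab) (x t : A) :
  shadow_map p ->
  t <= val (p x) <-> lbound (ubound [set x; a]) t /\ t <= b.
Proof. by move=> hp; rewrite -lboundU1E hp lbound1E. Qed.

(** The other description of the shadow, as [(x /\ b) \/ a]; this is a cut
    on [x]. *)
Lemma shadow_le d (A : porderType d) (a b : A) (hab : a <= b)
    (p : A -> subitv hab) (x w : A) :
  cut_rule A -> shadow_map p ->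
  val (p x) <= w <-> ubound (lbound [set x; b]) w /\ a <= w.
Proof.
move=> cut hp; split=> [pw|[wx aw]].
  split; last exact: le_trans (subitv_ge _) pw.
  move=> t /lbound2E[tx tb]; apply: le_trans pw.
  by apply/(le_shadow _ _ hp); split=> // v /ubound2E[xv _]; apply: le_trans xv.
have [px pb] : lbound (ubound [set x; a]) (val (p x)) /\ val (p x) <= b.
  exact/(le_shadow _ _ hp).
apply: (cut x) => [v /ubound2E[xv wv]|v /lbound2E[vx vp]].
  by apply: px; apply/ubound2E; split=> //; apply: le_trans aw _.
by apply: wx; apply/lbound2E; split=> //; apply: le_trans vp _.
Qed.

Lemma shadow_homo d (A : porderType d) (a b : A) (hab : a <= b)
    (p : A -> subitv hab) (x y : A) :
  shadow_map p -> x <= y -> p x <= p y.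
Proof.
move=> hp xy; apply/(le_shadow _ _ hp).
have [px pb] : lbound (ubound [set x; a]) (val (p x)) /\ val (p x) <= b.
  exact/(le_shadow _ _ hp).
split=> // v /ubound2E[yv av]; apply: px; apply/ubound2E.
by split=> //; apply: le_trans xy _.
Qed.

Lemma le_own_shadow d (A : porderType d) (a b : A) (hab : a <= b)
    (p : A -> subitv hab) (x : A) :
  shadow_map p -> x <= b -> x <= val (p x).
Proof. by move=> hp xb; apply/(le_shadow _ _ hp); split=> // v /ubound2E[]. Qed.

Lemma own_shadow_le d (A : porderType d) (a b : A) (hab : a <= b)
    (p : A -> subitv hab) (x : A) :
  shadow_map p -> a <= x -> val (p x) <= x.
Proof.
move=> hp ax.
have [px _] : lbound (ubound [set x; a]) (val (p x)) /\ val (p x) <= b.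
  exact/(le_shadow _ _ hp).
by apply: px; apply/ubound2E.
Qed.

Lemma shadow_id d (A : porderType d) (a b : A) (hab : a <= b)
    (p : A -> subitv hab) (c : subitv hab) :
  shadow_map p -> p (val c) = c.
Proof.
move=> hp; apply/val_inj/le_anti.
by rewrite own_shadow_le ?subitv_ge// le_own_shadow ?subitv_le.
Qed.

Lemma le_shadow_of d (A : porderType d) (a b : A) (hab : a <= b)
    (p : A -> subitv hab) (c : subitv hab) (x : A) :
  shadow_map p -> val c <= x -> c <= p x.
Proof. by move=> hp cx; rewrite -(shadow_id c hp); apply: shadow_homo. Qed.

Lemma shadow_le_of d (A : porderType d) (a b : A) (hab : a <= b)
    (p : A -> subitv hab) (c : subitv hab) (x : A) :
  shadow_map p -> x <= val c -> p x <= c.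
Proof. by move=> hp cx; rewrite -(shadow_id c hp); apply: shadow_homo. Qed.

(** * The interval is Boolean *)

(** Both premises of a cut in the interval hold in [A] as well, since a bound
    in [A] of elements of the interval has a shadow that is a tighter bound. *)
Lemma cut_subitv d (A : porderType d) (a b : A) (hab : a <= b)
    (p : A -> subitv hab) :
  cut_rule A -> shadow_map p -> cut_rule (subitv hab).
Proof.
move=> cut hp x t w txw wxt.
apply: (cut (val x)) => [v /ubound2E[xv wv]|v /lbound2E[vx vt]].
  have av : a <= v by apply: le_trans xv; apply: subitv_ge.
  apply: le_trans (own_shadow_le hp av).
  by apply: (txw (p v)); apply/ubound2E; split; apply: le_shadow_of.
have vb : v <= b by apply: le_trans vx _; apply: subitv_le.
apply: le_trans (le_own_shadow hp vb) _.
by apply: (wxt (p v)); apply/lbound2E; split; apply: shadow_le_of.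
Qed.

Lemma orthocomplementation_complemented d (P : tbPOrderType d) (c : P -> P) :
  orthocomplementation c -> complemented_poset P.
Proof.
move=> [_ cE] x; exists (c x); rewrite /complement_of; have [-> ->] := cE x.
split; apply/seteqP; split=> y.
- by move=> -> z _; apply: le0x.
- by move=> /(_ \bot I); rewrite lex0 => /eqP.
- by move=> -> z _; apply: lex1.
- by move=> /(_ \top I); rewrite le1x => /eqP.
Qed.

(** * The embedding *)

(** A lower bound of [x] and [(p x)'] is at most its own shadow, which is a
    lower bound of [p x] and its complement, hence [a]; dually for upper
    bounds. *)
Lemma ortho_twist d (A : porderType d) (a b : A) (hab : a <= b)
    (p : A -> subitv hab) (oc : subitv hab -> subitv hab) (x : A) :
  shadow_map p -> orthocomplementation oc ->
  (x, val (oc (p x))) \in twist_set [set a; b].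
Proof.
move=> hp [_ ocE]; have [oc0 oc1] := ocE (p x).
rewrite inE; split=> [w s /= /lbound2E[wx wo]|s w sab /= /ubound2E[xw ow]].
  have wb : w <= b by apply: le_trans wo _; apply: subitv_le.
  have : lbound [set p x; oc (p x)] (p w).
    by apply/lbound2E; split; [apply: shadow_homo|apply: shadow_le_of].
  rewrite oc0 => pw.
  have wa : w <= a by have := le_own_shadow hp wb; rewrite pw.
  by case=> ->; rewrite // (le_trans wa).
have aw : a <= w by apply: le_trans ow; apply: subitv_ge.
have : ubound [set p x; oc (p x)] (p w).
  by apply/ubound2E; split; [apply: shadow_homo|apply: le_shadow_of].
rewrite oc1 => pw.
have bw : b <= w by have := own_shadow_le hp aw; rewrite pw.
by case: sab => ->; rewrite // (le_trans hab).
Qed.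

Definition twist_embedding d (A : porderType d) (a b : A) (hab : a <= b)
    (p : A -> subitv hab) (oc : subitv hab -> subitv hab)
    (hp : shadow_map p) (hoc : orthocomplementation oc) (x : A) :
    twist [set a; b] :=
  exist _ (x, val (oc (p x))) (ortho_twist x hp hoc).

(** In each identity only one inclusion has content.  A pair bounding [f X] is
    to bound [f y] for every [y >= L(X)]; the first components are immediate,
    and for the second ones the involution reduces the claim to an inequality
    between shadows, which is a finite cut. *)
Lemma twist_embedding_LU d (A : porderType d) (a b : A) (hab : a <= b)
    (p : A -> subitv hab) (oc : subitv hab -> subitv hab)
    (hp : shadow_map p) (hoc : orthocomplementation oc) :
  cut_rule A -> LU_embedding (twist_embedding hp hoc).
Proof.
move=> cut; have [[ocN ocK] _] := hoc.
have ocNl c e : oc c <= e -> oc e <= c by move=> /ocN; rewrite ocK.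
have ocNr c e : c <= oc e -> e <= oc c by move=> /ocN; rewrite ocK.
split; last by move=> x y /andP[].
split.
- by move=> x y xy; apply/andP; split=> //; apply/ocN/shadow_homo.
- move=> X [x0 Xx0] /finite_seqP[s sE]; have sX x : x \in s = (X x) :> Prop.
    by rewrite sE.
  apply/seteqP; split=> q; last first.
    move=> qU _ [x Xx <-]; apply: qU; exists x => //.
    by move=> t; apply.
  move=> qX _ [y yX <-].
  have qx x : X x -> (val q).1 <= x /\ val (oc (p x)) <= (val q).2.
    by move=> Xx; apply/andP; apply: (qX (twist_embedding hp hoc x)); exists x.
  apply/andP; split; first by apply: yX => x /qx[].
  set u := (val q).2.
  have au : a <= u by apply: le_trans (qx _ Xx0).2; apply: subitv_ge.
  apply: le_trans (own_shadow_le hp au); apply/ocNl.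
  (* [(p u)'] is below all [p x] for [x] in [X]; a cut on the elements of [X]
     puts it below [p y]. *)
  apply/(le_shadow _ _ hp); split; last exact: subitv_le.
  move=> w /ubound2E[yw aw]; apply: (@cut_lower _ _ s) => // [x|t _ ts].
    rewrite sX => /qx[_ xu] v /ubound2E[xv wv].
    have /(le_shadow _ _ hp)[+ _] : oc (p u) <= p x.
      by apply/ocNl; apply: le_shadow_of.
    by apply; apply/ubound2E; split=> //; apply: le_trans aw _.
  by apply: le_trans yw; apply: yX => x; rewrite -sX => /ts.
- move=> Y [y0 Yy0] /finite_seqP[s sE]; have sY y : y \in s = (Y y) :> Prop.
    by rewrite sE.
  apply/seteqP; split=> q; last first.
    move=> qL _ [y Yy <-]; apply: qL; exists y => //.
    by move=> t; apply.
  move=> qY _ [x xY <-].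
  have qy y : Y y -> y <= (val q).1 /\ (val q).2 <= val (oc (p y)).
    by move=> Yy; apply/andP; apply: (qY (twist_embedding hp hoc y)); exists y.
  apply/andP; split; first by apply: xY => y /qy[].
  set u := (val q).2.
  have ub : u <= b by apply: le_trans (qy _ Yy0).2 _; apply: subitv_le.
  apply: le_trans (le_own_shadow hp ub) _; apply/ocNr.
  (* [(p u)'] is above all [p y] for [y] in [Y]; a cut on the elements of [Y]
     puts it above [p x]. *)
  apply/(shadow_le _ _ cut hp); split; last exact: subitv_ge.
  move=> t /lbound2E[tx tb]; apply: (@cut_upper _ _ s) => // [y|v _ vs].
    rewrite sY => /qy[_ uy] r /lbound2E[ry rt].
    have /(shadow_le _ _ cut hp)[+ _] : p y <= oc (p u).
      by apply/ocNr; apply: shadow_le_of.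
    by apply; apply/lbound2E; split=> //; apply: le_trans rt _.
  by apply: le_trans tx _; apply: xY => y; rewrite -sY => /vs.
Qed.

Theorem theorem3p1 (d : Order.disp_t) (A : porderType d)
    (A_distr : distributive_poset A)
    (a b : A) (hab : a <= b)
    (oc : subitv hab -> subitv hab) (oc_ortho : orthocomplementation oc)
    (hx : forall x : A,
        lbound [set a] `<` lbound (ubound [set x; a] `|` [set b]) ->
        lbound (ubound [set x; a] `|` [set b]) `<` lbound [set b] ->
        lbound (ubound [set x; a] `|` [set b]) = lbound [set x]) :
  (exists f : A -> twist [set a; b], LU_embedding f) /\
  boolean_poset (subitv hab).
Proof.
have cut := distributive_cut A_distr.
have [p hp] := shadow_map_exists hab hx.
split; first by exists (twist_embedding hp oc_ortho); apply: twist_embedding_LU.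
split; first exact/cut_distributive/(cut_subitv cut hp).
exact: orthocomplementation_complemented oc_ortho.
Qed.
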